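(* Let $G$ be a finite directed graph with vertex set $V$ and let $R=A_G$ be its all-paths transit function, i.e. $A_G(u,v)=\{x\in V\mid x\text{ lies on a directed path from }u\text{ to }v\}$. Then $R$ is a directed transit function on $V$ and satisfies the following: (tr2) for all $u,v,w\in V$ with $u\neq v$: if $R(u,w)=\emptyset$ or $R(w,v)=\emptyset$ then $w\notin R(u,v)$; (b5) for all $u,v,w\in V$: $R(u,w)\cap R(w,v)=\{w\}$ implies $R(u,w)\cup R(w,v)\subseteq R(u,v)$; (Mod) for all $u,v,w\in V$: $R(u,w)\neq\emptyset$ and $R(w,v)\neq\emptyset$ implies $R(u,v)\cap R(u,w)\cap R(w,v)\neq\emptyset$.
   Context: Directed graphs are finite, loopless and simple. A directed path from $u$ to $v$ is a sequence $(x_0=u,x_1,\dots,x_n=v)$ of pairwise distinct vertices with each $(x_{i-1},x_i)$ an edge; $n=0$ (a single vertex, $u=v$) is allowed. A directed transit function on a finite set $V$ is a function $R:V\times V\to 2^V$ satisfying (t0) for all $u,v,w\in V$: if $R(u,w)\neq\emptyset$ and $R(w,v)\neq\emptyset$ then $R(u,v)\neq\emptyset$; (t1) for all $u,v\in V$: if $R(u,v)\neq\emptyset$ then $\{u,v\}\subseteq R(u,v)$; (t3) $R(u,u)=\{u\}$ for all $u\in V$. *)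

(* Defs.v *)
From mathcomp Require Import all_boot.
From mathcomp Require Import boolp.

Set Implicit Arguments.
Unset Strict Implicit.
Unset Printing Implicit Defensive.

(* The path (x_0 = u, x_1, .., x_n = v) is encoded as u :: p with
   p = [:: x_1; ..; x_n]; n = 0 is p = [::], which forces u = v. *)
Definition dipath (V : finType) (e : rel V) (u v : V) (p : seq V) : bool :=
  [&& path e u p, last u p == v & uniq (u :: p)].

Definition all_paths (V : finType) (e : rel V) (u v : V) : {set V} :=
  [set x | `[< exists2 p : seq V, dipath e u v p & x \in u :: p >]].

Section TransitAxioms.
Variables (V : finType) (R : V -> V -> {set V}).

Definition ax_t0 : Prop :=
  forall u v w : V, R u w != set0 -> R w v != set0 -> R u v != set0.

Definition ax_t1 : Prop :=
  forall u v : V, R u v != set0 -> [set u; v] \subset R u v.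

Definition ax_t3 : Prop := forall u : V, R u u = [set u].

Definition directed_transit : Prop := [/\ ax_t0, ax_t1 & ax_t3].

Definition ax_tr2 : Prop :=
  forall u v w : V, u != v -> R u w = set0 \/ R w v = set0 -> w \notin R u v.

Definition ax_b5 : Prop :=
  forall u v w : V,
    R u w :&: R w v = [set w] -> R u w :|: R w v \subset R u v.

Definition ax_Mod : Prop :=
  forall u v w : V,
    R u w != set0 -> R w v != set0 -> R u v :&: R u w :&: R w v != set0.

End TransitAxioms.

(* Main.v *)
Require Import Defs.
From mathcomp Require Import all_boot.
From mathcomp Require Import boolp.

Set Implicit Arguments.
Unset Strict Implicit.
Unset Printing Implicit Defensive.

(** Cutting a path at one of its vertices gives (tr2), and gluing two paths
    that meet only at their common endpoint gives (b5).  For (Mod) and (t0),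
    follow a path P from u to w until its first vertex x lying on a path Q from
    w to v, then follow Q: the result is a path from u to v through x, and x
    lies on both P and Q. *)

Section AllPaths.
Variables (V : finType) (e : rel V).
Implicit Types (u v w x : V) (p q r : seq V).

Lemma all_pathsP u v x :
  reflect (exists2 p, dipath e u v p & x \in u :: p) (x \in all_paths e u v).
Proof. by rewrite inE; apply: asboolP. Qed.

Lemma all_paths_neq0P u v :
  reflect (exists p, dipath e u v p) (all_paths e u v != set0).
Proof.
apply: (iffP (set0Pn _)) => [[x /all_pathsP[p pP _]]|[p pP]]; first by exists p.
by exists u; apply/all_pathsP; exists p; rewrite ?mem_head.
Qed.

Lemma mem_dipath_last u v p : dipath e u v p -> v \in u :: p.
Proof. by case/and3P=> _ /eqP<- _; apply: mem_last. Qed.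

Lemma dipath_split u v w p : dipath e u v p -> w \in u :: p ->
  exists p1 p2, [/\ p = p1 ++ p2, dipath e u w p1 & dipath e w v p2].
Proof.
move=> pP w_p; case/splitPl: w_p pP => p1 p2 <-.
rewrite /dipath cat_path last_cat -cat_cons cat_uniq.
case/and3P=> /andP[ep1 ep2] lp /and3P[up1 /hasPn dis up2].
exists p1, p2; split; rewrite ?ep1 ?ep2 ?lp ?eqxx //=.
(* The vertex [w] ends [u :: p1], so distinctness of the whole path keeps it out of [p2]. *)
by rewrite up2 andbT; apply/negP => /dis; rewrite /= mem_last.
Qed.

Lemma dipath_cat u v w p q :
    dipath e u w p -> dipath e w v q ->
    (forall x, x \in u :: p -> x \in w :: q -> x = w) ->
  dipath e u v (p ++ q).
Proof.
case/and3P=> ep /eqP lp up /and3P[eq lq]; rewrite cons_uniq => /andP[wq uq] dis.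
rewrite /dipath cat_path last_cat lp ep eq lq -cat_cons cat_uniq up uq /= andbT.
(* A vertex of [q] that also lies on [u :: p] would be [w], which cannot recur in [q]. *)
apply/hasPn => x xq; apply: contraNN wq => xp.
by rewrite -(dis x xp) // in_cons xq orbT.
Qed.

(** Induction on [p]. The inclusion of [r] in [p ++ q] serves the induction: when [u] is off the
    second path, it shows that prepending [u] to the path built from the next vertex repeats no
    vertex. *)
Lemma dipath_meet u v w p q : dipath e u w p -> dipath e w v q ->
  exists r, [/\ dipath e u v r, {subset r <= p ++ q}
    & exists x, [/\ x \in u :: r, x \in u :: p & x \in w :: q]].
Proof.
move=> pP qP; elim: p u pP => [|y p IHp] u pP.
  by case/and3P: pP => _ /eqP/= -> _; exists q; split=> //; exists w; rewrite !mem_head.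
(* If [u] is already on the second path, the meeting vertex is [u] itself and [r] is the tail of
   that path from [u]. *)
have [u_q|u_nq] := boolP (u \in w :: q).
  have [q1 [r [Dq _ rP]]] := dipath_split qP u_q.
  exists r; split=> // [z zr|]; first by rewrite Dq !mem_cat zr !orbT.
  by exists u; rewrite !mem_head.
case/and3P: pP => /= /andP[euy ep] lp /andP[u_np up].
have [|r [rP sub_r [x [xr xp xq]]]] := IHp y; first by apply/and3P.
have sub_yr z : z \in y :: r -> z \in (y :: p) ++ q.
  by rewrite cat_cons !in_cons => /predU1P[->|/sub_r->]; rewrite ?eqxx ?orbT.
exists (y :: r); split=> //; last first.
  by exists x; rewrite ![x \in u :: _]in_cons xr xp !orbT.
case/and3P: rP => er lr ur; apply/and3P; split=> //; first by rewrite /= euy.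
rewrite cons_uniq ur andbT; apply/negP => /sub_yr; rewrite mem_cat (negPf u_np) /=.
by move=> u_q; rewrite in_cons u_q orbT in u_nq.
Qed.

Lemma all_paths_t1 : ax_t1 (all_paths e).
Proof.
move=> u v /all_paths_neq0P[p pP]; apply/subsetP => x.
by case/set2P=> ->; apply/all_pathsP; exists p;
  rewrite ?mem_head ?(mem_dipath_last pP).
Qed.

Lemma all_paths_t3 : ax_t3 (all_paths e).
Proof.
move=> u; apply/setP => x; rewrite in_set1; apply/all_pathsP/eqP => [[p]|->].
  (* A nonempty [p] would end at [u] and so repeat the starting vertex. *)
  case: p => [|y p] /and3P[_ /eqP lp]; first by rewrite inE => _ /eqP.
  by rewrite /= -{1}lp /= mem_last.
by exists [::]; rewrite ?mem_head // /dipath /= eqxx.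
Qed.

Lemma all_paths_tr2 : ax_tr2 (all_paths e).
Proof.
move=> u v w _ R0; apply/negP => /all_pathsP[p pP w_p].
have [p1 [p2 [_ p1P p2P]]] := dipath_split pP w_p.
by case: R0 => /eqP; apply/negP/all_paths_neq0P; [exists p1 | exists p2].
Qed.

Lemma all_paths_b5 : ax_b5 (all_paths e).
Proof.
move=> u v w Rw.
(* Any two such paths can be glued: a vertex common to both lies in both transit sets, hence equals
   [w] by [Rw]. *)
have glue p q : dipath e u w p -> dipath e w v q -> dipath e u v (p ++ q).
  move=> pP qP; apply: (dipath_cat pP qP) => x xp xq; apply/set1P.
  by rewrite -Rw inE; apply/andP; split; apply/all_pathsP;
    [exists p | exists q].
(* Since [w] is in the intersection, both sets are nonempty. This supplies [p0] and [q0], which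
   complete an arbitrary path on either side of [w] to one from [u] to [v]. *)
have: w \in all_paths e u w :&: all_paths e w v by rewrite Rw set11.
case/setIP=> /all_pathsP[p0 p0P _] /all_pathsP[q0 q0P _].
apply/subsetP => x /setUP[] /all_pathsP[p pP xp]; apply/all_pathsP.
  by exists (p ++ q0); rewrite ?glue // -cat_cons mem_cat xp.
exists (p0 ++ p); first exact: glue.
move: xp; rewrite -cat_cons mem_cat in_cons => /predU1P[->|->].
  by rewrite (mem_dipath_last p0P).
by rewrite orbT.
Qed.

Lemma all_paths_Mod : ax_Mod (all_paths e).
Proof.
move=> u v w /all_paths_neq0P[p pP] /all_paths_neq0P[q qP].
have [r [rP _ [x [xr xp xq]]]] := dipath_meet pP qP.
apply/set0Pn; exists x; rewrite !in_setI -andbA; apply/and3P.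
by split; apply/all_pathsP; [exists r | exists p | exists q].
Qed.

(** The common vertex provided by (Mod) lies in particular in the transit set from [u] to [v]. *)
Lemma all_paths_t0 : ax_t0 (all_paths e).
Proof.
move=> u v w Ruw Rwv; have /set0Pn[x] := all_paths_Mod Ruw Rwv.
by rewrite -setIA => /setIP[xR _]; apply/set0Pn; exists x.
Qed.

End AllPaths.

Theorem lemma35 (V : finType) (e : rel V) (e_irr : irreflexive e) :
  [/\ directed_transit (all_paths e),
      ax_tr2 (all_paths e),
      ax_b5 (all_paths e)
    & ax_Mod (all_paths e)].
Proof.
split; [split | | |].
- exact: all_paths_t0.
- exact: all_paths_t1.
- exact: all_paths_t3.
- exact: all_paths_tr2.
- exact: all_paths_b5.
- exact: all_paths_Mod.
Qed.
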